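(* Let $d\in\{-163,-67,-43,-19,-11,-7,-3,-2,-1\}$ and $z\in\mathcal O_{\mathbb{Q}(\sqrt{d})}\setminus\{0\}$, with $I_n^*$ computed in $\mathcal O_{\mathbb{Q}(\sqrt{d})}$. For every integer $n\ge 4$, $I_n^*(z)<2$. Furthermore, if $I_3^*(z)$ is rational, then $I_3^*(z)<2$.
   Context: $\mathcal O_{\mathbb{Q}(\sqrt{d})}$ is $\mathbb{Z}[\frac{1+\sqrt d}{2}]$ if $d\equiv 1 \pmod 4$ and $\mathbb{Z}[\sqrt d]$ if $d\equiv 2,3\pmod 4$; for the listed $d$ it is a unique factorization domain. Viewing elements as complex numbers, $|z|=\sqrt{z\bar z}$ and $\arg(z)\in[0,2\pi)$. Define $A(d)$ to be the set of nonzero $z\in\mathcal O_{\mathbb{Q}(\sqrt{d})}$ with $0\le\arg(z)<\pi/2$ if $d=-1$, with $0\le \arg(z)<\pi/3$ if $d=-3$, and with $0\le\arg(z)<\pi$ otherwise. Two elements are relatively prime if they have no nonunit common divisor. For nonzero $x,z$, write $x\Diamond z$ iff $x\in A(d)$, $x\mid z$, and $x$ is relatively prime to $z/x$. For $m\in\mathbb{Z}$ define $\delta_m^*(z)=\sum_{x\Diamond z}|x|^m$ and $I_m^*(z)=\delta_m^*(z)/|z|^m$ for nonzero $z$. *)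

(* Defs.v *)
From HB Require Import structures.
From mathcomp Require Import all_boot all_order all_algebra.
From mathcomp Require Import all_classical all_reals all_analysis.
Set Implicit Arguments. Unset Strict Implicit. Unset Printing Implicit Defensive.
Import Order.TTheory GRing.Theory Num.Theory.
Local Open Scope ring_scope.
Local Open Scope classical_set_scope.

Definition ds : seq int := [:: -163; -67; -43; -19; -11; -7; -3; -2; -1].

(* d = 1 mod 4 (intdiv's %% gives the nonnegative remainder). *)
Definition d1mod4 (d : int) : bool := (d %% 4)%Z == 1.

(* An element of O_{Q(sqrt d)} is encoded as a pair (a, b) standing for
   a + b*omega, where omega = (1 + sqrt d)/2 if d = 1 mod 4 and
   omega = sqrt d otherwise; {1, omega} is a Z-basis of O. *)
Definition OK := (int * int)%type.

Definition Ozero : OK := (0, 0).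
Definition Oone : OK := (1, 0).

(* Multiplication in O:  omega^2 = omega + (d-1)/4  resp.  omega^2 = d. *)
Definition Omul (d : int) (x y : OK) : OK :=
  let: (a, b) := x in let: (c, e) := y in
  if d1mod4 d then (a * c + b * e * ((d - 1) %/ 4)%Z, a * e + b * c + b * e)
  else (a * c + b * e * d, a * e + b * c).

Definition Odvd (d : int) (x z : OK) : Prop := exists y, z = Omul d x y.
Definition Ounit (d : int) (u : OK) : Prop := exists v, Omul d u v = Oone.
Definition Ocoprime (d : int) (x y : OK) : Prop :=
  forall c, Odvd d c x -> Odvd d c y -> Ounit d c.

(* Real and imaginary parts of the complex number a + b*omega (d < 0). *)
Definition ORe (R : realType) (d : int) (x : OK) : R :=
  if d1mod4 d then x.1%:~R + x.2%:~R / 2 else x.1%:~R.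
Definition OIm (R : realType) (d : int) (x : OK) : R :=
  if d1mod4 d then x.2%:~R * Num.sqrt (- d%:~R) / 2
  else x.2%:~R * Num.sqrt (- d%:~R).

Definition Oabs (R : realType) (d : int) (x : OK) : R :=
  Num.sqrt (ORe R d x ^+ 2 + OIm R d x ^+ 2).

Definition arg_in (R : realType) (re im lo hi : R) : Prop :=
  exists r t : R, [/\ 0 < r, lo <= t, t < hi, re = r * cos t & im = r * sin t].

Definition Aset (R : realType) (d : int) (x : OK) : Prop :=
  x <> Ozero /\
  arg_in (ORe R d x) (OIm R d x) 0
    (if d == -1 then pi / 2 else if d == -3 then pi / 3 else pi).

Definition diamond (R : realType) (d : int) (x z : OK) : Prop :=
  Aset R d x /\ exists y, z = Omul d x y /\ Ocoprime d x y.

Definition delta_star (R : realType) (d : int) (m : int) (z : OK) : R :=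
  \sum_(x \in [set x | diamond R d x z]) Oabs R d x ^ m.

Definition I_star (R : realType) (d : int) (m : int) (z : OK) : R :=
  delta_star R d m z / Oabs R d z ^ m.

(* Main.v *)
Require Import Defs.
From HB Require Import structures.
From Stdlib Require Import ZArith.
From mathcomp Require Import all_boot all_order all_algebra.
From mathcomp Require Import all_classical all_reals all_analysis.
From mathcomp Require Import zify ssrZ ring lra.
Import Order.TTheory GRing.Theory Num.Theory.
Local Open Scope ring_scope.

(* If z = x y with x in A(d), then |x|^n / |z|^n = |y|^-n, and distinct x give
   nonassociate y.  So I_n^*(z) is at most the sum of |y|^-n over representatives of the
   nonzero elements modulo units.  For n >= 4 that full lattice sum is already below 2
   (the worst case, d = -7, gives about 1.895): sum the points of max-norm at most 20
   and bound the rest by 4 N(y) >= 3 max(|a|, |b|)^2.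
   For n = 3, a rational sum of nonnegative square roots of rationals has only rational
   terms; so if I_3^*(z) is rational, every |y| that occurs is an integer, and the sum of
   |y|^-3 over the lattice points of square norm is below 2 by the same estimate. *)

(** * Multiplication and norm in a Z-basis of the ring of integers *)

(* Trace and norm of omega. *)
Definition Otr (d : int) : int := if d1mod4 d then 1 else 0.
Definition Onr (d : int) : int := if d1mod4 d then - ((d - 1) %/ 4)%Z else - d.
Definition Onorm (d : int) (x : OK) : int :=
  x.1 * x.1 + Otr d * (x.1 * x.2) + Onr d * (x.2 * x.2).

Lemma OmulE d x y : Omul d x y =
  (x.1 * y.1 - Onr d * (x.2 * y.2), x.1 * y.2 + x.2 * y.1 + Otr d * (x.2 * y.2)).
Proof.
case: x y => [a b] [c e]; rewrite /Omul /Otr /Onr /=.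
by case: (d1mod4 d); congr (_, _); ring.
Qed.

Lemma OnormM d x y : Onorm d (Omul d x y) = Onorm d x * Onorm d y.
Proof. by rewrite OmulE /Onorm /=; ring. Qed.

(** The second factor is the conjugate of [y], as the conjugate of omega is its trace minus omega.
    Cancellation by [y] thus reduces to cancelling the integer [Onorm d y]. *)
Lemma Omul_conj d x y :
  Omul d (Omul d x y) (y.1 + Otr d * y.2, - y.2) =
  (Onorm d y * x.1, Onorm d y * x.2).
Proof. by rewrite !OmulE /Onorm /=; congr (_, _); ring. Qed.

Lemma ds_ind (P : int -> Prop) :
  P (-163) -> P (-67) -> P (-43) -> P (-19) -> P (-11) -> P (-7) -> P (-3) ->
  P (-2) -> P (-1) -> forall d, d \in ds -> P d.
Proof.
move=> P163 P67 P43 P19 P11 P7 P3 P2 P1 d; rewrite /ds !inE.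
by do 8 (case/orP => [/eqP->//|]); move/eqP->.
Qed.

Lemma Otr_Onr d : d \in ds -> Otr d * Otr d = Otr d /\ 1 <= Onr d.
Proof. by move: d; apply: ds_ind. Qed.

Definition Omax (y : OK) : nat := maxn `|y.1|%N `|y.2|%N.

(** Complete the square in either variable: for trace 1, 4N - 3a^2 = (a + 2b)^2 + 4(q - 1)b^2 and 4N
    - 3b^2 = (2a + b)^2 + 4(q - 1)b^2. The constant 3 is sharp for d = -3. *)
Lemma Onorm_ge_max d y : d \in ds ->
  3 * (Omax y)%:Z * (Omax y)%:Z <= 4 * Onorm d y.
Proof.
move=> /Otr_Onr[t2 q1]; case: y => [a b]; rewrite /Onorm /Omax /=.
set t := Otr d in t2 *; set q := Onr d in q1 *.
have t1 : t = 0 \/ t = 1.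
  have /eqP : t * (t - 1) = 0 by rewrite mulrBr t2 mulr1 subrr.
  by rewrite mulf_eq0 subr_eq0 => /orP[] /eqP; [left|right].
have q0 : 0 <= (q - 1) * (b * b) by rewrite mulr_ge0 ?subr_ge0 // -expr2 sqr_ge0.
have h0 : 0 <= (a + 2 * b) * (a + 2 * b) by rewrite -expr2 sqr_ge0.
have h1 : 0 <= (2 * a + b) * (2 * a + b) by rewrite -expr2 sqr_ge0.
have h2 : 0 <= a * a by rewrite -expr2 sqr_ge0.
have h3 : 0 <= b * b by rewrite -expr2 sqr_ge0.
have ha : 3 * (a * a) <= 4 * (a * a + t * (a * b) + q * (b * b)).
  by case: t1 => ->; lra.
have hb : 3 * (b * b) <= 4 * (a * a + t * (a * b) + q * (b * b)).
  by case: t1 => ->; lra.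
rewrite /maxn; case: ifP => _.
  apply: le_trans hb; lia.
apply: le_trans ha; lia.
Qed.

Lemma Omax_gt0 y : y <> Ozero -> (0 < Omax y)%N.
Proof.
case: y => a b ab; rewrite lt0n; apply/eqP; rewrite /Omax /= => m0.
by apply: ab; congr (_, _); lia.
Qed.

Lemma Onorm_gt0 d y : d \in ds -> y <> Ozero -> 0 < Onorm d y.
Proof. by move=> dds /Omax_gt0; have := Onorm_ge_max d y dds; nia. Qed.

Lemma Omul_cancel d x x' y : d \in ds -> y <> Ozero ->
  Omul d x y = Omul d x' y -> x = x'.
Proof.
move=> dds /(Onorm_gt0 _ _ dds) N0 e.
have := Omul_conj d x y; rewrite e Omul_conj => -[].
move=> /(mulfI (lt0r_neq0 N0)) e1 /(mulfI (lt0r_neq0 N0)) e2.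
by case: x x' e1 e2 {e} => [? ?] [? ?] /= -> ->.
Qed.

(** * Representatives modulo units, and cofactors of divisors *)

(* Contains A(d), and meets the orbit of each nonzero element under [Ounits d] exactly once. *)
Definition Osector (d : int) (x : OK) : bool :=
  if (d == -1) || (d == -3) then (0 < x.1) && (0 <= x.2)
  else (0 < x.2) || ((x.2 == 0) && (0 < x.1)).

Lemma Osector_neq0 d y : Osector d y -> y <> Ozero.
Proof. by move=> sy y0; move: sy; rewrite y0 /Osector; case: ifP. Qed.

Lemma Onorm_sector_gt0 d y : d \in ds -> Osector d y -> 0 < Onorm d y.
Proof. by move=> dds /Osector_neq0; apply: Onorm_gt0. Qed.

(** The powers of i for d = -1, and those of the primitive sixth root of unity omega for d = -3, in
    order of argument. *)
Definition Ounits (d : int) : seq OK :=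
  if d == -1 then [:: (1, 0); (0, 1); (-1, 0); (0, -1)]
  else if d == -3 then [:: (1, 0); (0, 1); (-1, 1); (-1, 0); (0, -1); (1, -1)]
  else [:: (1, 0); (-1, 0)].

Lemma Onorm_unit d u : d \in ds -> u \in Ounits d -> Onorm d u = 1.
Proof.
move=> dds; move: d dds u.
by apply: ds_ind => u; rewrite !inE => h;
  repeat (case/orP: h => [/eqP-> //|] h); move/eqP: h => ->.
Qed.

Lemma Omul_m1 x y : Omul (-1) x y =
  (x.1 * y.1 - x.2 * y.2, x.1 * y.2 + x.2 * y.1).
Proof. by rewrite OmulE (_ : Otr _ = 0) // (_ : Onr _ = 1) //; congr (_, _); ring. Qed.

Lemma Omul_m3 x y : Omul (-3) x y =
  (x.1 * y.1 - x.2 * y.2, x.1 * y.2 + x.2 * y.1 + x.2 * y.2).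
Proof. by rewrite OmulE (_ : Otr _ = 1) // (_ : Onr _ = 1) //; congr (_, _); ring. Qed.

Lemma Omul_pm1 d (e : int) y : Omul d (e, 0) y = (e * y.1, e * y.2).
Proof. by rewrite OmulE /=; congr (_, _); ring. Qed.

Lemma Osector_unit d y : y <> Ozero ->
  exists2 u, u \in Ounits d & Osector d (Omul d u y).
Proof.
move=> /Omax_gt0; case: y => a b; rewrite /Omax /= => ab0.
have {}ab0 : a <> 0 \/ b <> 0 by lia.
(* As a boolean [has], the claim becomes a finite disjunction of linear inequalities. *)
apply/(hasP (s := Ounits d) (a := fun u => Osector d (Omul d u (a, b)))).
rewrite /Osector /Ounits; have [->|d1] /= := eqVneq d (-1).
  by lia.
have [->|d3] /= := eqVneq d (-3).
  by have -> : ((-3 - 1) %/ 4)%Z = -1 by []; lia.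
by rewrite /=; case: (d1mod4 d) => /=; lia.
Qed.

(** The relation x1 / x2 = u1 / u2 is stated cross-multiplied, so that no inverse of a unit is
    required; each pair of units leaves a linear problem. *)
Lemma Osector_unit_inj d u1 u2 x1 x2 :
  u1 \in Ounits d -> u2 \in Ounits d -> Osector d x1 -> Osector d x2 ->
  Omul d u2 x1 = Omul d u1 x2 -> x1 = x2.
Proof.
have pair_inj (a b a' b' : int) : a = a' /\ b = b' -> (a, b) = (a', b').
  by case=> -> ->.
case: u1 u2 x1 x2 => [p q] [p' q'] [a b] [a' b'].
rewrite /Osector /Ounits; have [->|d1] := eqVneq d (-1).
  rewrite !Omul_m1 /= !inE !xpair_eqE /= => h1 h2 /andP[s1 s2] /andP[s1' s2'] [e1 e2].
  apply: pair_inj.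
  by repeat (case/orP: h1 => h1); repeat (case/orP: h2 => h2);
    case/andP: h1 => /eqP? /eqP?; case/andP: h2 => /eqP? /eqP?; subst; lia.
have [->|d3] := eqVneq d (-3).
  rewrite !Omul_m3 /= !inE !xpair_eqE /= => h1 h2 /andP[s1 s2] /andP[s1' s2'] [e1 e2].
  apply: pair_inj.
  by repeat (case/orP: h1 => h1); repeat (case/orP: h2 => h2);
    case/andP: h1 => /eqP? /eqP?; case/andP: h2 => /eqP? /eqP?; subst; lia.
rewrite !inE !xpair_eqE => h1 h2 s1 s2.
by case/orP: h1 => /andP[/eqP-> /eqP->]; case/orP: h2 => /andP[/eqP-> /eqP->];
  rewrite !Omul_pm1 => -[e1 e2]; apply: pair_inj; move: s1 s2 e1 e2; clear => /=; lia.
Qed.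

(** Here [f x] is the sector associate of z / x. It determines z / x up to a unit, hence x up to a
    unit, hence x itself within the sector. *)
Lemma Odvd_cofactor d z : d \in ds -> z <> Ozero ->
  exists f : OK -> OK,
    (forall x, Osector d x -> Odvd d x z ->
      Osector d (f x) /\ Onorm d z = Onorm d x * Onorm d (f x)) /\
    (forall x x', Osector d x -> Odvd d x z -> Osector d x' -> Odvd d x' z ->
      f x = f x' -> x = x').
Proof.
move=> dds z0.
have /choice[f fP] (x : OK) : exists y', Osector d x -> Odvd d x z ->
    Osector d y' /\ exists u y, [/\ u \in Ounits d, z = Omul d x y & y' = Omul d u y].
  have [[xs [y zxy]]|nx] := pselect (Osector d x /\ Odvd d x z); last first.
    by exists Ozero => *; case: nx.
  have y0 : y <> Ozero.
    by move=> y0; apply: z0; rewrite zxy y0 OmulE /= !mulr0 subrr.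
  have [u uu su] := Osector_unit d y y0.
  by exists (Omul d u y) => _ _; split=> //; exists u, y.
exists f; split=> [x xs xz|x x' xs xz xs' xz' fxx'].
  have [sf [u [y [uu zxy fx]]]] := fP x xs xz; split=> //.
  by rewrite zxy fx !OnormM (Onorm_unit d u) // mul1r.
have [sf [u [y [uu zxy fx]]]] := fP x xs xz.
have [sf' [u' [y' [uu' zxy' fx']]]] := fP x' xs' xz'.
have fx0 := Osector_neq0 _ _ sf.
apply: (Osector_unit_inj d u u' x x') => //.
apply: (Omul_cancel d _ _ (f x)) => //.
rewrite {1}fx fxx' fx'.
(* Both sides equal u u' z, since z = x y = x' y'. *)
have -> : Omul d (Omul d u' x) (Omul d u y) = Omul d (Omul d u u') (Omul d x y).
  by rewrite !OmulE /=; congr (_, _); ring.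
rewrite -zxy zxy'.
by rewrite !OmulE /=; congr (_, _); ring.
Qed.

(** * Shells of constant max-norm and the tail estimate *)

(* The points of max-norm k in the half-plane b > 0 or b = 0 < a (for k > 0). *)
Definition shell (k : nat) : seq OK :=
  [seq (i%:Z - k%:Z, k%:Z) | i <- iota 0 (2 * k + 1)] ++
  [seq (k%:Z, j%:Z) | j <- iota 0 k] ++
  [seq (- k%:Z, j%:Z) | j <- iota 1 k.-1].

Lemma size_shell k : (0 < k)%N -> size (shell k) = (4 * k)%N.
Proof. by rewrite /shell !size_cat !size_map !size_iota; lia. Qed.

Lemma Omax_shell k y : y \in shell k -> Omax y = k.
Proof.
rewrite /shell !mem_cat => /or3P[] /mapP[i]; rewrite mem_iota => hi ->;
  rewrite /Omax /=; lia.
Qed.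

Lemma mem_shell d y : Osector d y -> y \in shell (Omax y).
Proof.
case: y => a b; rewrite /Osector => hy.
(* Every sector lies in this half-plane, so the same shells serve all d. *)
have {}hy : (0 <= b) && ((b != 0) || (0 < a)).
  by move: hy; case: ifP => _ /=; lia.
rewrite /shell /Omax /= !mem_cat; set k := maxn _ _.
have [hk|hk] := eqVneq b k%:Z.
  apply/orP; left; apply/mapP; exists (absz (a + k%:Z)).
    by rewrite mem_iota; lia.
  by congr (_, _) => //; lia.
have [ha|ha] := eqVneq a k%:Z.
  apply/orP; right; apply/orP; left; apply/mapP; exists (absz b).
    by rewrite mem_iota; lia.
  by congr (_, _) => //; lia.
apply/orP; right; apply/orP; right; apply/mapP; exists (absz b).
  by rewrite mem_iota; lia.
by congr (_, _) => //; lia.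
Qed.

Definition shells (m n : nat) : seq OK := flatten [seq shell k | k <- iota m n].

Lemma mem_shells d y m n : Osector d y -> (m <= Omax y < m + n)%N -> y \in shells m n.
Proof.
move=> /mem_shell sy hy; apply/flattenP; exists (shell (Omax y)) => //.
by apply: map_f; rewrite mem_iota.
Qed.

Lemma ler_sum_subset (R : realType) (T : eqType) (f : T -> R) (s t : seq T) :
  uniq s -> {subset s <= t} -> (forall x, 0 <= f x) ->
  \sum_(x <- s) f x <= \sum_(x <- t) f x.
Proof.
move=> + + f0; elim: s t => [|x s IHs] t /= => [_ _|/andP[xs us] st].
  by rewrite big_nil sumr_ge0.
rewrite big_cons (perm_big _ (perm_to_rem (st x (mem_head _ _)))) /= big_cons.
rewrite lerD2l IHs // => y ys; have yt : y \in t by apply: st; rewrite inE ys orbT.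
by move: yt; rewrite (perm_mem (perm_to_rem (st x (mem_head _ _)))) inE;
  case/orP => // /eqP yx; rewrite -yx ys in xs.
Qed.

(** Shell k has 4k points, each contributing k^-3, and 4 / k^2 <= 4 / (k - 1) - 4 / k telescopes. *)
Lemma shells_tail (R : realType) (m n : nat) : (0 < m)%N ->
  \sum_(y <- shells m.+1 n) ((Omax y)%:R ^+ 3)^-1 <= 4 / m%:R - 4 / (m + n)%:R :> R.
Proof.
elim: n m => [|n IHn] m m0; first by rewrite big_nil addn0 subrr.
have -> : shells m.+1 n.+1 = shell m.+1 ++ shells m.+2 n by [].
have {}IHn := IHn m.+1 isT; rewrite big_cat addnS -addSn /=.
suff h : \sum_(y <- shell m.+1) ((Omax y)%:R ^+ 3)^-1 <= 4 / m%:R - 4 / m.+1%:R :> R.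
  by apply: le_trans (lerD h IHn) _; rewrite addrA subrK.
rewrite (eq_big_seq (fun=> (m.+1%:R ^+ 3)^-1)); last by move=> y /Omax_shell ->.
rewrite big_const_seq count_predT size_shell // iter_addr addr0.
rewrite -[_ *+ (4 * _)]mulr_natl natrM.
have p0 : 0 < m%:R :> R by rewrite ltr0n.
have e : m.+1%:R = m%:R + 1 :> R by rewrite natr1.
rewrite !e {e}; set x := m%:R in p0 *.
have -> : 4 / x - 4 / (x + 1) = 4 / (x * (x + 1)) by field; lra.
have -> : 4 * (x + 1) / (x + 1) ^+ 3 = 4 / ((x + 1) * (x + 1)) by field; lra.
rewrite ler_pM2l // lef_pV2 ?posrE; nra.
Qed.

(** * Reduction of a lattice sum to a finite integer computation *)

(** Binary integers let [vm_compute] evaluate the box sums; this map carries the results to the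
    reals. *)
Definition real_of_Z (R : realType) (x : Z) : R := (int_of_Z x)%:~R.

Lemma ler_real_of_Z (R : realType) x y : (real_of_Z R x <= real_of_Z R y) = Z.leb x y.
Proof. by rewrite ler_int; lia. Qed.

Lemma real_of_ZD (R : realType) x y :
  real_of_Z R (Z.add x y) = real_of_Z R x + real_of_Z R y.
Proof. by rewrite /real_of_Z -intrD; congr _%:~R; lia. Qed.

Lemma real_of_ZM (R : realType) x y :
  real_of_Z R (Z.mul x y) = real_of_Z R x * real_of_Z R y.
Proof. by rewrite /real_of_Z -intrM; congr _%:~R; lia. Qed.

Lemma real_of_Z_int (R : realType) (n : int) : real_of_Z R (Z_of_int n) = n%:~R.
Proof. by rewrite /real_of_Z Z_of_intK. Qed.

Definition Zsum {T : Type} (h : T -> Z) (s : seq T) : Z :=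
  foldr (fun y => Z.add (h y)) Z0 s.

Lemma real_of_Zsum (R : realType) (T : Type) (h : T -> Z) (s : seq T) :
  real_of_Z R (Zsum h s) = \sum_(y <- s) real_of_Z R (h y).
Proof. by elim: s => [|y s IHs]; rewrite ?big_nil // big_cons /= real_of_ZD IHs. Qed.

(* [h / scale] dominates [g] in the box of max-norm at most [K]; since shell k has 4k
   points, the rest contributes at most [\sum_(k > K) 4C / k^2 <= 4C / K]. *)
Lemma sector_sum (R : realType) (d : int) (g : OK -> R) (h : OK -> Z)
    (scale : Z) (K p q : nat) (C : R) (s : seq OK) :
  Z.ltb 0 scale -> (0 < K)%N -> (0 < q)%N -> 0 <= C -> (forall y, Z.leb 0 (h y)) ->
  Z.leb (Z.mul (Z.of_nat q) (Zsum h (shells 1 K))) (Z.mul (Z.of_nat p) scale) ->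
  uniq s -> (forall y, y \in s -> Osector d y) ->
  (forall y, y \in s -> g y <= real_of_Z R (h y) / real_of_Z R scale) ->
  (forall y, y \in s -> (K < Omax y)%N -> g y <= C * ((Omax y)%:R ^+ 3)^-1) ->
  \sum_(y <- s) g y <= p%:R / q%:R + 4 * C / K%:R.
Proof.
move=> S0 K0 q0 C0 h0 hpq us ss gh gC.
have {}S0 : 0 < real_of_Z R scale by rewrite ltr0z; lia.
rewrite (bigID (fun y => Omax y <= K)%N) /= -big_filter -[X in _ + X]big_filter; apply: lerD.
  have -> : p%:R / q%:R = p%:R * real_of_Z R scale / q%:R / real_of_Z R scale.
    by field; rewrite !gt_eqF ?ltr0n.
  apply: (@le_trans _ _ (real_of_Z R (Zsum h (shells 1 K)) / real_of_Z R scale)).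
    rewrite real_of_Zsum big_distrl /=.
    apply: (@le_trans _ _ (\sum_(y <- [seq y <- s | (Omax y <= K)%N])
        real_of_Z R (h y) / real_of_Z R scale)).
      rewrite big_seq [leRHS]big_seq; apply: ler_sum => y.
      by rewrite mem_filter => /andP[_ /gh].
    apply: ler_sum_subset => [||y]; first exact: filter_uniq.
      move=> y; rewrite mem_filter => /andP[yK /ss sy].
      apply: (mem_shells d) => //; rewrite add1n ltnS yK andbT.
      exact/Omax_gt0/(Osector_neq0 _ _ sy).
    by rewrite mulr_ge0 ?invr_ge0 ?(ltW S0) // -[0]/(real_of_Z R Z0) ler_real_of_Z.
  rewrite ler_pM2r ?invr_gt0 // ler_pdivlMr ?ltr0n // mulrC.
  have := hpq; rewrite -(ler_real_of_Z R) !real_of_ZM.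
  by rewrite -[Z.of_nat q]/(Z_of_int q) -[Z.of_nat p]/(Z_of_int p) !real_of_Z_int.
(* The total of all max-norms is a crude bound for each of them, so finitely many shells contain
   [t]. *)
set t := [seq y <- s | _]; pose M := (\sum_(y <- t) Omax y)%N.
have tM y : y \in t -> (K < Omax y <= M)%N.
  move=> yt; have := yt; rewrite mem_filter -ltnNge => /andP[-> _] /=.
  by rewrite /M (big_rem y) //= leq_addr.
apply: (@le_trans _ _ (\sum_(y <- t) C * ((Omax y)%:R ^+ 3)^-1)).
  rewrite big_seq [leRHS]big_seq; apply: ler_sum => y yt; apply: gC.
    by move: yt; rewrite mem_filter => /andP[].
  by have /andP[] := tM y yt.
rewrite -mulr_sumr -mulrA mulrCA; apply: ler_wpM2l => //.
apply: (@le_trans _ _ (\sum_(y <- shells K.+1 M) ((Omax y)%:R ^+ 3)^-1)).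
  apply: ler_sum_subset => [||y]; first exact: filter_uniq.
    move=> y yt; have /andP[Ky yM] := tM y yt; apply: (mem_shells d).
      by apply: ss; move: yt; rewrite mem_filter => /andP[].
    by rewrite Ky /=; lia.
  by rewrite invr_ge0 exprn_ge0.
apply: le_trans (shells_tail R K M K0) _.
by rewrite lerBlDr lerDl divr_ge0.
Qed.

(** * Numerical bounds for the two lattice sums *)

Definition OnormZ (t q : Z) (y : OK) : Z :=
  let a := Z_of_int y.1 in let b := Z_of_int y.2 in
  Z.add (Z.mul a a) (Z.add (Z.mul t (Z.mul a b)) (Z.mul q (Z.mul b b))).

Lemma OnormZE d y :
  OnormZ (Z_of_int (Otr d)) (Z_of_int (Onr d)) y = Z_of_int (Onorm d y).
Proof. rewrite /OnormZ /Onorm; lia. Qed.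

(** Floor plus one: for n > 0 it exceeds scale / n by at most 1, even when the division is exact. *)
Definition ceil_inv (scale n : Z) : Z := Z.succ (Z.div scale n).

(** The value is 0 off the sector because the shells fill the half-plane, which is larger than the
    sector for d = -1 and d = -3. Binding [t] and [q] outside the function lets them be evaluated
    once. *)
Definition inv_norm2 (scale : Z) (d : int) : OK -> Z :=
  let t := Z_of_int (Otr d) in let q := Z_of_int (Onr d) in fun y =>
  if Osector d y then let n := OnormZ t q y in ceil_inv scale (Z.mul n n)
  else Z0.

(** Only points of square norm count; for them r = |y| and r n = |y|^3. *)
Definition inv_abs3 (scale : Z) (d : int) : OK -> Z :=
  let t := Z_of_int (Otr d) in let q := Z_of_int (Onr d) in fun y =>
  if Osector d y then
    let n := OnormZ t q y in let r := Z.sqrt n in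
    if Z.eqb (Z.mul r r) n then ceil_inv scale (Z.mul r n) else Z0
  else Z0.

(** The box of max-norm at most 20 has 840 half-plane points, so rounding costs at most 0.00084. *)
Definition scale : Z := Zpos 1000000%positive.

Lemma inv_norm2_box d : d \in ds ->
  Z.leb (Z.mul (Z.of_nat 10) (Zsum (inv_norm2 scale d) (shells 1 20)))
        (Z.mul (Z.of_nat 19) scale).
Proof. by move: d; apply: ds_ind; vm_compute. Qed.

Lemma inv_abs3_box d : d \in ds ->
  Z.leb (Z.mul (Z.of_nat 20) (Zsum (inv_abs3 scale d) (shells 1 20)))
        (Z.mul (Z.of_nat 31) scale).
Proof. by move: d; apply: ds_ind; vm_compute. Qed.

Lemma ceil_inv_ge0 s n : Z.leb Z0 s -> Z.leb Z0 n -> Z.leb Z0 (ceil_inv s n).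
Proof.
move=> /Z.leb_le s0 /Z.leb_le n0; apply/Z.leb_le; rewrite /ceil_inv.
apply: Z.le_le_succ_r; have [->|n1] := Z.eq_dec n Z0; first by rewrite Zdiv.Zdiv_0_r.
by apply: Z.div_pos => //; lia.
Qed.

Lemma inv_norm2_ge0 d y : Z.leb Z0 (inv_norm2 scale d y).
Proof.
rewrite /inv_norm2; case: ifP => // _; apply: ceil_inv_ge0 => //.
exact/Z.leb_le/Z.square_nonneg.
Qed.

Lemma inv_abs3_ge0 d y : Z.leb Z0 (inv_abs3 scale d y).
Proof.
rewrite /inv_abs3; case: ifP => // _; case: ifP => // /Z.eqb_eq h.
apply: ceil_inv_ge0 => //; apply/Z.leb_le/Z.mul_nonneg_nonneg.
  exact: Z.sqrt_nonneg.
by rewrite -h; apply: Z.square_nonneg.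
Qed.

Lemma ler_ceil_inv (R : realType) s n : Z.ltb Z0 s -> Z.ltb Z0 n ->
  (real_of_Z R n)^-1 <= real_of_Z R (ceil_inv s n) / real_of_Z R s.
Proof.
move=> s0 n0.
have pos x : Z.ltb Z0 x -> 0 < real_of_Z R x by move=> ?; rewrite ltr0z; lia.
rewrite ler_pdivlMr ?pos // ler_pdivrMl ?pos // -real_of_ZM ler_real_of_Z.
apply/Z.leb_le/Z.lt_le_incl/Z.mul_succ_div_gt; lia.
Qed.

Lemma sum_inv_norm2 (R : realType) (d : int) (s : seq OK) : d \in ds ->
  uniq s -> (forall y, y \in s -> Osector d y) ->
  \sum_(y <- s) ((Onorm d y)%:~R ^+ 2)^-1 < 2 :> R.
Proof.
move=> dds us ss.
(* For k = [Omax y] >= 21, N >= 3k^2 / 4 gives N^-2 <= 16 / (9 k^4) <= 16 / (189 k^3). The total is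
   about 1.917. *)
suff : \sum_(y <- s) ((Onorm d y)%:~R ^+ 2)^-1 <=
    19%:R / 10%:R + 4 * (16 / 189) / 20%:R :> R by lra.
apply: (@sector_sum R d _ (inv_norm2 scale d) scale) => // [||y ys|y ys Ky].
- exact: inv_norm2_ge0.
- exact: inv_norm2_box.
- rewrite /inv_norm2 ss // OnormZE.
  have -> : (Onorm d y)%:~R ^+ 2 =
      real_of_Z R (Z.mul (Z_of_int (Onorm d y)) (Z_of_int (Onorm d y))).
    by rewrite real_of_ZM real_of_Z_int expr2.
  apply: ler_ceil_inv => //; have := Onorm_sector_gt0 d y dds (ss y ys); nia.
have := Onorm_ge_max d y dds; rewrite -(ler_int R) !rmorphM /=.
set N := (Onorm d y)%:~R; rewrite -pmulrn; set k : R := (Omax y)%:R => hN.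
have k21 : 21%:R <= k by rewrite ler_nat.
rewrite -[16 / 189]invf_div -invfM lef_pV2 ?posrE; last 2 first.
- by rewrite exprn_gt0 //; nra.
- by rewrite mulr_gt0 ?exprn_gt0 //; lra.
have h1 : 0 <= (4 * N - 3 * k * k) * (4 * N + 3 * k * k) by nra.
have h2 : 0 <= (k - 21%:R) * k ^+ 3 by rewrite mulr_ge0 ?exprn_ge0; lra.
by lra.
Qed.

Lemma sum_inv_abs3 (R : realType) (d : int) (s : seq OK) : d \in ds ->
  uniq s -> (forall y, y \in s -> Osector d y) ->
  (forall y, y \in s -> exists k : nat, Onorm d y = (k ^ 2)%N) ->
  \sum_(y <- s) (Num.sqrt (Onorm d y)%:~R ^+ 3)^-1 < 2 :> R.
Proof.
move=> dds us ss sq.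
(* From N >= 3k^2 / 4 follows |y| >= 3k / 4, with 3/4 a rational substitute for sqrt 3 / 2; hence
   |y|^3 >= 9k^3 / 16. The total is about 1.906. *)
suff : \sum_(y <- s) (Num.sqrt (Onorm d y)%:~R ^+ 3)^-1 <=
    31%:R / 20%:R + 4 * (16 / 9) / 20%:R :> R by lra.
apply: (@sector_sum R d _ (inv_abs3 scale d) scale) => // [||y ys|y ys Ky].
- exact: inv_abs3_ge0.
- exact: inv_abs3_box.
- have [k Nk] := sq y ys; have N0 := Onorm_sector_gt0 d y dds (ss y ys).
  have k0 : (0 < k)%N by move: N0; rewrite Nk; case: k {Nk}.
  pose k3 := Z.mul (Z.of_nat k) (Z.mul (Z.of_nat k) (Z.of_nat k)).
  have -> : inv_abs3 scale d y = ceil_inv scale k3.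
    rewrite /inv_abs3 ss // OnormZE Nk.
    have -> : Z_of_int (k ^ 2)%N = Z.mul (Z.of_nat k) (Z.of_nat k) by lia.
    by rewrite Z.sqrt_square ?Z.eqb_refl //; lia.
  have -> : Num.sqrt (Onorm d y)%:~R ^+ 3 = real_of_Z R k3.
    rewrite Nk -pmulrn natrX sqrtr_sqr ger0_norm // !real_of_ZM.
    by rewrite -[Z.of_nat k]/(Z_of_int k) real_of_Z_int -pmulrn !exprS expr0 mulr1.
  by apply: ler_ceil_inv => //; rewrite /k3; nia.
have := Onorm_ge_max d y dds; rewrite -(ler_int R) !rmorphM /=.
have := Onorm_sector_gt0 d y dds (ss y ys); rewrite -(ltr_int R).
set N := (Onorm d y)%:~R; rewrite -pmulrn; set k : R := (Omax y)%:R => N0 hN.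
have k21 : 21%:R <= k by rewrite ler_nat.
have := sqr_sqrtr (ltW N0); have := sqrtr_ge0 N; set r := Num.sqrt N => r0 r2.
have rk : 3 / 4 * k <= r by rewrite -(@ler_pXn2r _ 2) ?nnegrE //; nra.
rewrite -[16 / 9]invf_div -invfM lef_pV2 ?posrE; last 2 first.
- by rewrite exprn_gt0 //; nra.
- by rewrite mulr_gt0 ?exprn_gt0 //; lra.
have -> : r ^+ 3 = r * N by rewrite -r2; ring.
have h : 3 / 4 * k * (3 / 4 * k * k) <= r * N by apply: ler_pM => //; nra.
by lra.
Qed.

(** * Rational sums of square roots *)

(** Separate the even and odd powers of s. As [A] and [B] depend only on s^2, they serve both s and
    -s. *)
Lemma horner_add_sqrt (R : realType) (a : rat) (p : {poly rat}) :
  exists A B : {poly rat}, forall x s : R, s ^+ 2 = ratr a ->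
    (map_poly ratr p).[x + s] =
    (map_poly ratr A).[x] + s * (map_poly ratr B).[x].
Proof.
elim/poly_ind: p => [|p c [A [B AB]]].
  by exists 0, 0 => x s _; rewrite !rmorph0 !horner0 mulr0 addr0.
exists (A * 'X + a *: B + c%:P), (B * 'X + A) => x s s2.
rewrite !rmorphD !rmorphM /= map_polyZ !map_polyX !map_polyC !hornerE /= (AB x s s2).
by rewrite -s2; ring.
Qed.

(* The witness is the product of [t - \sum_i +- s_i] over all signs. *)
Lemma sum_sqrt_annihilator (R : realType) (l : seq R) :
  (forall s, s \in l -> 0 <= s /\ exists a : rat, s ^+ 2 = ratr a) ->
  exists p : {poly rat}, root (map_poly ratr p) (\sum_(s <- l) s) /\
    forall t : R, root (map_poly ratr p) t -> `|t| <= \sum_(s <- l) s.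
Proof.
elim: l => [_|s l IHl hl].
  exists 'X; rewrite map_polyX big_nil; split=> [|t]; first by rewrite /root hornerX.
  by rewrite /root hornerX => /eqP->; rewrite normr0.
have [|p [p_root p_bound]] := IHl.
  by move=> t tl; apply: hl; rewrite inE tl orbT.
have [s0 [a s2]] := hl s (mem_head _ _).
have [A [B AB]] := horner_add_sqrt R a p.
(* This is (A + s B)(A - s B), that is p(t + s) p(t - s), with rational coefficients. *)
exists (A ^+ 2 - a *: B ^+ 2).
have E t : (map_poly ratr (A ^+ 2 - a *: B ^+ 2)).[t] =
    (map_poly ratr p).[t + s] * (map_poly ratr p).[t - s].
  rewrite (AB t s s2) (AB t (- s)) ?sqrrN // rmorphB /= map_polyZ !rmorphXn /=.
  by rewrite !(hornerD, hornerN, hornerZ, horner_exp) -s2; ring.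
rewrite big_cons /root; split=> [|t]; rewrite E mulf_eq0.
  by apply/orP; right; rewrite addrAC subrr add0r.
by case/orP => /p_bound; rewrite !ler_norml => /andP[? ?]; apply/andP; split; lra.
Qed.

(** The sum q - s of the other terms is a root of a rational polynomial p, so A(q) = s B(q), which
    makes s rational if B(q) is nonzero. Otherwise q + s is a root too, and the bound on roots
    forces s = 0; nonnegativity of the terms enters through that bound. *)
Lemma sum_sqrt_rational (R : realType) (l : seq R) (q : rat) :
  (forall s, s \in l -> 0 <= s /\ exists a : rat, s ^+ 2 = ratr a) ->
  \sum_(s <- l) s = ratr q ->
  forall s, s \in l -> exists r : rat, s = ratr r.
Proof.
move=> hl sum_q s sl.
have [s0 [a s2]] := hl s sl.
have [|p [p_root p_bound]] := sum_sqrt_annihilator R (rem s l).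
  by move=> t /mem_rem; apply: hl.
move: sum_q; rewrite (big_rem s) //=; set S := \sum_(t <- _) t in p_root p_bound *.
move=> sum_q.
have [A [B AB]] := horner_add_sqrt R a p.
have hA : (map_poly ratr A).[ratr q : R] = ratr A.[q] by rewrite horner_map.
have hB : (map_poly ratr B).[ratr q : R] = ratr B.[q] by rewrite horner_map.
have : (map_poly ratr p).[ratr q + - s] = 0.
  by apply/eqP; rewrite -sum_q addrAC subrr add0r.
rewrite AB ?sqrrN // hA hB => ABs.
(* If A.[q] and B.[q] vanish, then q + s is a root exceeding the bound q - s, unless s = 0. *)
have [B0|B0] := eqVneq B.[q] 0.
  have : root (map_poly ratr p) (ratr q + s).
    apply/eqP; rewrite AB // hA hB B0; move: ABs; rewrite B0 rmorph0; lra.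
  move=> /p_bound; rewrite ler_norml => /andP[_ h].
  by exists 0; rewrite rmorph0; lra.
exists (A.[q] / B.[q]); rewrite fmorph_div; apply: (canRL (mulfK _)).
  by rewrite fmorph_eq0.
by lra.
Qed.

(** In lowest terms the squared denominator divides the squared numerator, so it is 1. *)
Lemma rat_sqrt_int (n : nat) (r : rat) : r ^+ 2 = n%:R -> exists k : nat, n = (k ^ 2)%N.
Proof.
move=> rn; exists `|numq r|%N.
have nr : (numq r)%:~R = r * (denq r)%:~R :> rat by rewrite numqE.
have e : numq r ^+ 2 = n%:Z * denq r ^+ 2.
  apply: (@intr_inj rat); rewrite !expr2 !intrM nr; rewrite expr2 in rn.
  by rewrite -[n%:~R]rn; ring.
have e' : (`|numq r| ^ 2 = n * `|denq r| ^ 2)%N.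
  by rewrite -!abszX e abszM.
suff d1 : `|denq r|%N = 1%N by rewrite e' d1 exp1n muln1.
have c := coprime_num_den r.
have : coprime (`|numq r| ^ 2) (`|denq r| ^ 2) by rewrite coprimeXl ?coprimeXr.
rewrite e' coprime_sym /coprime (gcdn_idPl (dvdn_mull _ (dvdnn _))) -(exp1n 2) eqn_sqr.
by move/eqP.
Qed.

(** * Complex absolute value and argument in coordinates *)

Lemma ds_lt0 d : d \in ds -> d < 0.
Proof. by move: d; apply: ds_ind. Qed.

Lemma OabsE (R : realType) d x : d \in ds ->
  Oabs R d x = Num.sqrt (Onorm d x)%:~R.
Proof.
move=> dds; have dR : 0 <= - d%:~R :> R by rewrite oppr_ge0 lerz0 ltW ?ds_lt0.
have s2 := sqr_sqrtr dR.
rewrite /Oabs /ORe /OIm /Onorm /Otr /Onr; congr Num.sqrt.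
case: ifP => [/eqP d4|_].
  have dq : d%:~R = 4 * ((d - 1) %/ 4)%Z%:~R + 1 :> R.
    have {1}-> : d = 4 * ((d - 1) %/ 4)%Z + 1 by lia.
    by rewrite rmorphD rmorphM.
  by rewrite !exprMn s2 dq !(rmorphD, rmorphM, rmorphN) /=; field.
by rewrite exprMn s2 !(rmorphD, rmorphM, rmorphN) /=; ring.
Qed.

Lemma Aset_sector (R : realType) d x : d \in ds -> Aset R d x -> Osector d x.
Proof.
move=> dds [_ [r [t [r0 t0]]]].
have [->|d1] := eqVneq d (-1).
  rewrite /ORe /OIm /= => t_hi re im; rewrite /Osector /=.
  rewrite opprK sqrtr1 mulr1 in im.
  have c0 : 0 < cos t by apply: cos_gt0_pihalf; have := pi_gt0 R; lra.
  have s0 : 0 <= sin t by apply: sin_ge0_pi; have := pi_gt0 R; lra.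
  by rewrite -(ltr0z R) -(ler0z R) re im mulr_gt0 // mulr_ge0 // ltW.
have [->|d3] := eqVneq d (-3).
  rewrite /ORe /OIm /= => t_hi re im; rewrite /Osector /=.
  have c0 : 0 < cos t by apply: cos_gt0_pihalf; have := pi_gt0 R; lra.
  have q3 : Num.sqrt (3 : R) ^+ 2 = 3 by rewrite sqr_sqrtr.
  have q30 : 0 < Num.sqrt (3 : R) by rewrite sqrtr_gt0.
  rewrite opprK in im.
  have [t00|tn0] := eqVneq t 0.
    rewrite t00 cos0 sin0 in re im.
    have x20 : (x.2)%:~R = 0 :> R by nra.
    by rewrite -(ltr0z R) -(ler0z R) x20 lexx andbT; lra.
  have t_gt0 : 0 < t by rewrite lt_neqAle eq_sym tn0.
  have s0 : 0 < sin t by apply: sin_gt0_pi; have := pi_gt0 R; lra.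
  (* sin 3t > 0 gives tan^2 t < 3, which is [x.1 > 0]. *)
  have s3 : 0 < sin (t + t + t) by apply: sin_gt0_pi; lra.
  have cs := cos2Dsin2 t.
  rewrite sinD sinD cosD in s3.
  (* Uses sin 3t = sin t (3 cos^2 t - sin^2 t). *)
  have h4 : 0 < 3 * cos t ^+ 2 - sin t ^+ 2 by rewrite -(pmulr_rgt0 _ s0); lra.
  have x2 : 0 < (x.2)%:~R :> R by nra.
  have h5 : 3 * (x.2)%:~R ^+ 2 = 4 * r ^+ 2 * sin t ^+ 2.
    have -> : 4 * r ^+ 2 * sin t ^+ 2 = (2 * (r * sin t)) ^+ 2 by ring.
    by rewrite -im -[X in X * _ = _]q3; field.
  (* Since r cos t = x.1 + x.2 / 2, this says x.1 > 0. *)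
  have h6 : (x.2)%:~R < 2 * r * cos t.
    rewrite -(@ltr_pXn2r _ 2) ?nnegrE ?ltW // ?mulr_gt0 //.
    have : 0 < r ^+ 2 * (3 * cos t ^+ 2 - sin t ^+ 2) by rewrite mulr_gt0 ?exprn_gt0.
    by lra.
  have x1 : 0 < (x.1)%:~R :> R by lra.
  by rewrite -(ltr0z R) -(ler0z R) x1 ltW.
move=> /= t_hi re im; rewrite /Osector (negPf d1) (negPf d3) /=.
have w0 : 0 < Num.sqrt (- d%:~R) :> R by rewrite sqrtr_gt0 oppr_gt0 ltrz0 ds_lt0.
rewrite -!(ltr0z R) -(eqr_int R).
have [t00|tn0] := eqVneq t 0.
  rewrite t00 cos0 sin0 mulr0 mulr1 in re im.
  have x2 : (x.2)%:~R = 0 :> R.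
    by move: im; rewrite /OIm; case: ifP => _; nra.
  move: re; rewrite /ORe x2 mul0r addr0 if_same eqxx => ->.
  by rewrite r0 orbT.
have s0 : 0 < sin t by apply: sin_gt0_pi; rewrite t_hi andbT lt_neqAle eq_sym tn0.
suff -> : 0 < (x.2)%:~R :> R by [].
have : 0 < OIm R d x by rewrite im mulr_gt0.
by rewrite /OIm; case: ifP => _; nra.
Qed.

(** * The sum over cofactors and the final estimates *)

(** A sum over a set runs over its finite support, or over the empty list if the support is
    infinite; a list describes both cases. *)
Lemma fsbig_seq_in (V : nmodType) (T : choiceType) (P : set T) (F : T -> V) :
  exists s : seq T, [/\ uniq s, forall x, x \in s -> P x &
    \sum_(x \in P) F x = \sum_(x <- s) F x].
Proof.
exists (finite_support 0 P F); split=> // x.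
by case: finite_supportP => // X XP _ _ xX; apply: XP.
Qed.

(** The term |x|^m / |z|^m is |f x|^-m for the cofactor map f, whose injectivity keeps the list free
    of repetitions. *)
Lemma I_star_cofactors (R : realType) (d : int) (z : OK) (m : int) :
  d \in ds -> z <> Ozero ->
  exists s : seq OK, [/\ uniq s, forall y, y \in s -> Osector d y &
    I_star R d m z = \sum_(y <- s) (Num.sqrt (Onorm d y)%:~R ^ m)^-1].
Proof.
move=> dds z0; rewrite /I_star /delta_star.
have [s [us sP ->]] := fsbig_seq_in _ _ [set x | diamond R d x z]%classic
  (fun x => Oabs R d x ^ m).
have [f [fP f_inj]] := Odvd_cofactor d z dds z0.
have sf x : x \in s -> Osector d x /\ Odvd d x z.
  move=> /sP [/(Aset_sector _ _ _ dds) xs [y [zxy _]]].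
  by split=> //; exists y.
exists (map f s); split.
- rewrite map_inj_in_uniq // => x x' /sf[xs xz] /sf[xs' xz'].
  exact: f_inj.
- by move=> _ /mapP[x /sf[xs xz] ->]; have [] := fP x xs xz.
rewrite big_map mulr_suml; apply: eq_big_seq => x /sf[xs xz].
have [fs Nz] := fP x xs xz.
have N0 y : Osector d y -> 0 < (Onorm d y)%:~R :> R.
  by move=> sy; rewrite ltr0z Onorm_sector_gt0.
(* The exponent may be negative, so splitting the power requires invertible factors. *)
rewrite !OabsE // Nz rmorphM sqrtrM ?ltW ?N0 //= exprMz_comm; last 3 first.
- by rewrite unitfE sqrtr_eq0 -ltNge N0.
- by rewrite unitfE sqrtr_eq0 -ltNge N0.
- exact: mulrC.
rewrite invfM mulrA divff ?mul1r // expfz_neq0 //.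
by rewrite sqrtr_eq0 -ltNge N0.
Qed.

Theorem theorem2p1 (R : realType) (d : int) (z : OK) :
  d \in ds -> z <> Ozero ->
  (forall n : int, 4 <= n -> I_star R d n z < 2) /\
  ((exists q : rat, I_star R d 3 z = ratr q) -> I_star R d 3 z < 2).
Proof.
move=> dds z0; split=> [n n4|[q Iq]].
  have [s [us ss ->]] := I_star_cofactors R d z n dds z0.
  (* As |y| >= 1 and n >= 4, |y|^-n <= |y|^-4 = N(y)^-2. *)
  apply: le_lt_trans (sum_inv_norm2 R d s dds us ss).
  rewrite big_seq [leRHS]big_seq; apply: ler_sum => y /ss sy.
  have N1 : 1 <= (Onorm d y)%:~R :> R.
    by rewrite ler1z -gtz0_ge1 Onorm_sector_gt0.
  have r1 : 1 <= Num.sqrt (Onorm d y)%:~R :> R.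
    by rewrite -[leLHS]sqrtr1 ler_wsqrtr.
  have -> : (Onorm d y)%:~R ^+ 2 = Num.sqrt (Onorm d y)%:~R ^ 4 :> R.
    by rewrite -[in LHS](sqr_sqrtr (le_trans ler01 N1)) -exprM.
  rewrite lef_pV2 ?posrE ?exprz_gt0 ?(lt_le_trans ltr01) //.
  exact: ler_weXz2l.
have [s [us ss Is]] := I_star_cofactors R d z 3 dds z0.
rewrite Is; apply: sum_inv_abs3 => // y ys.
have N_gt0 x : x \in s -> 0 < (Onorm d x)%:~R :> R.
  by move=> /ss sx; rewrite ltr0z Onorm_sector_gt0.
have N0 := N_gt0 y ys.
(* Each term |y|^-3 is the nonnegative square root of the rational N(y)^-3. *)
have [] := @sum_sqrt_rational R [seq (Num.sqrt (Onorm d y)%:~R ^+ 3)^-1 | y <- s] q _ _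
  (Num.sqrt (Onorm d y)%:~R ^+ 3)^-1.
- move=> _ /mapP[x /N_gt0 Nx0 ->]; split; first by rewrite invr_ge0 exprn_ge0 ?sqrtr_ge0.
  exists ((Onorm d x)%:~R ^+ 3)^-1.
  by rewrite fmorphV rmorphXn /= ratr_int exprVn exprAC sqr_sqrtr ?ltW.
- by rewrite big_map -Iq Is.
- exact: map_f.
move=> r rE.
have sqrtN0 : Num.sqrt (Onorm d y)%:~R != 0 :> R by rewrite sqrtr_eq0 -ltNge.
(* From r = |y|^-3 and N = |y|^2, |y| = 1 / (r N). *)
have sqrtN : Num.sqrt (Onorm d y)%:~R = ratr (r * (Onorm d y)%:~R)^-1 :> R.
  rewrite fmorphV rmorphM /= -rE ratr_int -[X in _ * X](sqr_sqrtr (ltW N0)).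
  by field.
have [k Nk] : exists k : nat, absz (Onorm d y) = (k ^ 2)%N.
  apply: (rat_sqrt_int _ (r * (Onorm d y)%:~R)^-1).
  apply: (fmorph_inj (@ratr R)); rewrite rmorphXn /= -sqrtN sqr_sqrtr ?ltW //.
  by rewrite ratr_nat pmulrn gtz0_abs // -(ltr0z R).
by exists k; rewrite -Nk gtz0_abs // -(ltr0z R).
Qed.
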